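(* Let $n \geq 2$. Let $\mathfrak{g}_n \subseteq \mathbb{C}S_n$ be the Lie subsuperalgebra of $\mathbb{C}S_n$ generated by all transpositions in $S_n$, let $T_n \in \mathbb{C}S_n$ be the sum of all transpositions in $S_n$, and let $\mathfrak{D}(\mathbb{C}S_n)$ be the derived subalgebra of the Lie superalgebra $\mathbb{C}S_n$. Then $$\mathfrak{g}_n = \mathfrak{D}(\mathbb{C}S_n) + \mathbb{C}\cdot T_n.$$
   Context: The group algebra $\mathbb{C}S_n$ of the symmetric group is a $\mathbb{Z}_2$-graded algebra (superalgebra): its even part is $\mathbb{C}A_n$, the span of the even permutations, and its odd part is the span of the odd permutations. It is a Lie superalgebra via the super commutator, defined on homogeneous elements by $[x,y] = xy - (-1)^{\overline{x}\cdot\overline{y}}yx$, where $\overline{x}\in\mathbb{Z}_2$ denotes the superdegree of $x$, and extended bilinearly. For a Lie superalgebra $\mathfrak{s}$, the derived subalgebra is $\mathfrak{D}(\mathfrak{s}) = [\mathfrak{s},\mathfrak{s}]$, the linear span of all brackets $[x,y]$ with $x,y\in\mathfrak{s}$. *)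

(* Defs.v *)
From HB Require Import structures.
From mathcomp Require Import all_boot all_order all_algebra all_fingroup.
From mathcomp Require Import classical_sets reals.
From mathcomp Require Export complex.

Set Implicit Arguments.
Unset Strict Implicit.
Unset Printing Implicit Defensive.

Import GRing.Theory.
Local Open Scope classical_set_scope.
Local Open Scope ring_scope.

(* The wrapper keeps the pointwise vector space structure of finite functions  *)
(* but replaces their pointwise product by convolution.                        *)
Definition group_algebra (F : fieldType) (gT : finGroupType) : Type :=
  {ffun gT -> F^o}.

Section GroupAlgebra.
Variables (F : fieldType) (gT : finGroupType).
Local Notation A := (group_algebra F gT).
Implicit Types (x y z : A) (g h : gT).

HB.instance Definition _ := GRing.Lmodule.copy A {ffun gT -> F^o}.
HB.instance Definition _ := Vector.copy A {ffun gT -> F^o}.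

Definition ga_delta g : A := [ffun h => (h == g)%:R].

Definition ga_mul x y : A := [ffun g => \sum_h x h * y (h^-1 * g)%g].

Lemma ga_mulA : associative ga_mul.
Proof.
move=> x y z; apply/ffunP => g; rewrite !ffunE.
under eq_bigr => h _ do rewrite ffunE mulr_sumr.
under [RHS]eq_bigr => k _ do rewrite ffunE mulr_suml.
rewrite [RHS]exchange_big /=; apply: eq_bigr => h _.
rewrite (reindex_inj (mulgI h^-1%g)) /=; apply: eq_bigr => k _.
by rewrite mulrA invMg invgK -mulgA mulKVg.
Qed.

Lemma ga_mul1l : left_id (ga_delta 1%g) ga_mul.
Proof.
move=> x; apply/ffunP => g; rewrite ffunE (bigD1 1%g) //= big1 => [|h hN1].
  by rewrite ffunE eqxx mul1r invg1 mul1g addr0.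
by rewrite ffunE (negbTE hN1) mul0r.
Qed.

Lemma ga_mul1r : right_id (ga_delta 1%g) ga_mul.
Proof.
move=> x; apply/ffunP => g; rewrite ffunE (bigD1 g) //= big1 => [|h hNg].
  by rewrite ffunE mulVg eqxx mulr1 addr0.
rewrite ffunE; case: eqP => [/(canRL (mulKVg h))|_]; last by rewrite mulr0.
by rewrite mulg1 => gh; rewrite gh eqxx in hNg.
Qed.

Lemma ga_mulDl : left_distributive ga_mul +%R.
Proof.
move=> x y z; apply/ffunP => g; rewrite !ffunE -big_split /=.
by apply: eq_bigr => h _; rewrite ffunE mulrDl.
Qed.

Lemma ga_mulDr : right_distributive ga_mul +%R.
Proof.
move=> x y z; apply/ffunP => g; rewrite !ffunE -big_split /=.
by apply: eq_bigr => h _; rewrite ffunE mulrDr.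
Qed.

Lemma ga_oner_neq0 : ga_delta 1%g != 0.
Proof.
apply/eqP => /ffunP/(_ 1%g); rewrite !ffunE eqxx => /eqP.
by rewrite (negbTE (oner_neq0 F)).
Qed.

HB.instance Definition _ := GRing.Zmodule_isNzRing.Build A
  ga_mulA ga_mul1l ga_mul1r ga_mulDl ga_mulDr ga_oner_neq0.

Lemma ga_scaleAl (a : F) x y : a *: (x * y) = (a *: x) * y.
Proof.
apply/ffunP => g; rewrite !ffunE scaler_sumr; apply: eq_bigr => h _.
by rewrite ffunE -mulrA.
Qed.

Lemma ga_scaleAr (a : F) x y : a *: (x * y) = x * (a *: y).
Proof.
apply/ffunP => g; rewrite !ffunE scaler_sumr; apply: eq_bigr => h _.
by rewrite ffunE [RHS]mulrCA.
Qed.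

HB.instance Definition _ := GRing.Lmodule_isLalgebra.Build F A ga_scaleAl.
HB.instance Definition _ := GRing.Lalgebra_isAlgebra.Build F A ga_scaleAr.

Lemma ga_deltaM g h : ga_delta g * ga_delta h = ga_delta (g * h)%g.
Proof.
apply/ffunP => k; rewrite ffunE (bigD1 g) //= big1 => [|l lNg].
  rewrite !ffunE eqxx mul1r addr0.
  by rewrite -(inj_eq (mulgI g)) mulKVg.
by rewrite ffunE (negbTE lNg) mul0r.
Qed.

End GroupAlgebra.

Section SymmetricSuperalgebra.
Variables (F : fieldType) (n : nat).
Local Notation A := (group_algebra F 'S_n).
Implicit Types (x y : A) (a b : bool) (U : set A).

(* Superdegrees are booleans (false = even, true = odd); [super_part b x] is   *)
(* the component of [x] of superdegree [b], and [x] is homogeneous of          *)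
(* superdegree [b] when [super_part b x = x].                                  *)
Definition super_part b x : A :=
  [ffun s : 'S_n => if odd_perm s == b then x s else 0].

Definition super_bracket x y : A :=
  \sum_(a : bool) \sum_(b : bool)
    (super_part a x * super_part b y
     - (-1) ^+ (a && b) *: (super_part b y * super_part a x)).

Lemma super_part_id b x c :
  super_part b x = x -> super_part c x = if c == b then x else 0.
Proof.
move=> xb; case: eqP => [->//|/eqP cNb]; rewrite -xb; apply/ffunP => s.
rewrite !ffunE; case: (odd_perm s =P c) => // ->.
by rewrite (negbTE cNb).
Qed.

Lemma super_bracket_homogeneous a b x y :
    super_part a x = x -> super_part b y = y ->
  super_bracket x y = x * y - (-1) ^+ (a && b) *: (y * x).
Proof.
move=> xa yb; rewrite /super_bracket (bigD1 a) //= [X in _ + X]big1 => [|c cNa].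
  rewrite (bigD1 b) //= [X in _ + X + _]big1 => [|d dNb].
    by rewrite xa yb !addr0.
  by rewrite (super_part_id _ yb) (negbTE dNb) mulr0 mul0r scaler0 subr0.
rewrite big1 // => d _.
by rewrite (super_part_id _ xa) (negbTE cNa) mulr0 mul0r scaler0 subr0.
Qed.

Record subspace U : Prop := Subspace {
  subspace0 : U 0;
  subspaceD : forall x y, U x -> U y -> U (x + y);
  subspaceZ : forall (c : F) x, U x -> U (c *: x) }.

Definition linear_span (S : set A) : set A := smallest subspace S.

Record lie_subsuperalgebra U : Prop := LieSubsuperalgebra {
  lie_subspace : subspace U;
  lie_graded : forall b x, U x -> U (super_part b x);
  lie_bracket : forall x y, U x -> U y -> U (super_bracket x y) }.

Definition lie_generated (S : set A) : set A := smallest lie_subsuperalgebra S.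

Definition derived_subalgebra U : set A :=
  linear_span [set super_bracket x y | x in U & y in U].

Definition is_transposition (s : 'S_n) : bool :=
  [exists i, exists j, (i != j) && (s == tperm i j)].

Definition transpositions : set A :=
  [set ga_delta F s | s in [set s : 'S_n | is_transposition s]].

Definition transposition_sum : A :=
  \sum_(s : 'S_n | is_transposition s) ga_delta F s.

End SymmetricSuperalgebra.

Arguments transpositions : clear implicits.
Arguments transposition_sum : clear implicits.

(* Main.v *)
(* Write L for the generated superalgebra, d_h for the basis vector of h.  For
   h = x y the bracket [d_x, d_y] equals d_h -+ d_(h^x), so the inclusion of the
   derived subalgebra in L says that every h is congruent modulo L to each of
   its conjugates, up to a prescribed sign.  The x for which this holds form a
   group G(h), because L is stable under conjugation.

   One shows by induction on #|S| that G(h) contains Sym(S) for h in Sym(S); by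
   induction, x is in G(h) as soon as x and h have a common fixed point in S.
   If #|S| <= 3, odd permutations are transpositions.  Let #|S| >= 4.  If h
   fixes p, then G(h) contains the stabiliser of p, and it contains
   (p b)(q h(q)) for any b outside {p, q, h(q)}.  If h has no fixed point in S,
   then the transpositions (i h(i)) are in G(h), and so are the products
   (i h(i))(c d) if #|S| >= 5; this leaves a small verification if #|S| = 4.

   Conversely D(CS_n) + C T is a graded subalgebra, and it contains the
   transpositions because differences of transpositions are in D(CS_n). *)

Require Import Defs.
From mathcomp Require Import all_boot all_order all_algebra all_fingroup.
From mathcomp Require Import classical_sets reals complex.

Set Implicit Arguments.
Unset Strict Implicit.
Unset Printing Implicit Defensive.

Import GRing.Theory.

(** * Permutations supported on a subset, and generation by transpositions *)

Section Permutations.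

Lemma ex_notin_seq (T : finType) (S : {set T}) (s : seq T) :
  (size s < #|S|)%N -> exists2 x, x \in S & x \notin s.
Proof.
move=> ltsS; case: (pickP [pred x in S | x \notin s]) => [x /andP[xS xs]|S0].
  by exists x.
suff /subset_leq_card : S \subset s.
  by move=> /leq_trans /(_ (card_size s)); rewrite leqNgt ltsS.
by apply/fintype.subsetP => x xS; have := S0 x; rewrite /= xS /= => /negbFE.
Qed.

Lemma leq_size_card (T : finType) (S : {set T}) (s : seq T) :
  uniq s -> all (mem S) s -> (size s <= #|S|)%N.
Proof.
by move=> /card_uniqP<- /allP sS; apply/subset_leq_card/fintype.subsetP.
Qed.

Lemma mem_seq_of_card (T : finType) (S : {set T}) (s : seq T) i :
  (#|S| <= size s)%N -> uniq s -> all (mem S) s -> i \in S -> i \in s.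
Proof.
move=> leSs us sS iS; apply: contraTT leSs => si; rewrite -ltnNge.
by apply: (@leq_size_card _ _ (i :: s)); rewrite /= ?si ?iS.
Qed.

Lemma perm_neq1 (T : finType) (s : {perm T}) :
  s != 1%g -> exists i, s i != i.
Proof.
move=> s1; case: (pickP (fun i => s i != i)) => [i si|s0]; first by exists i.
by case/eqP: s1; apply/permP => i; rewrite perm1; apply/eqP/negbFE/s0.
Qed.

Lemma perm_on_moved (T : finType) (S : {set T}) (s : {perm T}) i :
  perm_on S s -> s i != i -> i \in S.
Proof. by move=> sS; apply: contraNT => /(out_perm sS)->. Qed.

Lemma perm_on_setD1 (T : finType) (S : {set T}) (s : {perm T}) p :
  perm_on S s -> s p = p -> perm_on (S :\ p) s.
Proof.
move=> sS sp; apply/fintype.subsetP => i; rewrite !inE => si.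
rewrite (perm_on_moved sS si) andbT; apply: contra_neq si => ->; exact: sp.
Qed.

Lemma perm_on_tperm (T : finType) (S : {set T}) i j :
  i \in S -> j \in S -> perm_on S (tperm i j).
Proof.
move=> iS jS; apply/fintype.subsetP => k; rewrite inE.
by case: tpermP => [->|->|]; rewrite // eqxx.
Qed.

(** Induction on the number of moved points: if [s] sends [i] to [j != i], then [tperm i j * s]
    fixes [j] and moves no point that [s] fixes. *)
Lemma perm_on_tperm_ind (T : finType) (S : {set T}) (P : {perm T} -> Prop) :
    P 1%g -> (forall i j, i \in S -> j \in S -> i != j -> P (tperm i j)) ->
    (forall s t, P s -> P t -> P (s * t)%g) ->
  forall s, perm_on S s -> P s.
Proof.
move=> P1 Pt PM s.
have [m] := ubnP #|[set i | s i != i]|; elim: m s => // m IHm s lem sS.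
have [->//|/perm_neq1[i si]] := eqVneq s 1%g.
pose j := s i; pose w := (tperm i j * s)%g.
have wj : w j = j by rewrite permM tpermR.
have iS : i \in S by apply: perm_on_moved si.
have jS : j \in S by rewrite perm_closed.
have -> : s = (tperm i j * w)%g by rewrite mulgA tperm2 mul1g.
apply: PM; first by apply: Pt; rewrite // eq_sym.
apply: IHm; last by apply: perm_onM => //; apply: perm_on_tperm.
rewrite ltnS in lem; apply: leq_trans lem; apply: proper_card.
apply/properP; split.
  apply/fintype.subsetP => k; rewrite !inE permM; case: tpermP => [->|->|//].
    by rewrite si.
  by rewrite eqxx.
by exists j; rewrite !inE ?wj ?eqxx // (inj_eq perm_inj).
Qed.

End Permutations.

Local Open Scope classical_set_scope.
Local Open Scope ring_scope.

(** * Bilinearity of the super bracket, and conjugation on the group algebra *)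

Section Subspaces.
Variables (F : fieldType) (n : nat).
Local Notation A := (group_algebra F 'S_n).
Local Notation delta := (@ga_delta F 'S_n).
Implicit Types (x y : A) (U : set A) (s t : 'S_n).

Lemma subspaceN U x : subspace U -> U x -> U (- x).
Proof. by move=> sU Ux; rewrite -scaleN1r; apply: subspaceZ. Qed.

Lemma subspaceB U x y : subspace U -> U x -> U y -> U (x - y).
Proof. by move=> sU Ux Uy; apply: subspaceD => //; apply: subspaceN. Qed.

Lemma subspace_sum U : subspace U ->
  forall (I : Type) (r : seq I) (P : pred I) (f : I -> A),
  (forall i, P i -> U (f i)) -> U (\sum_(i <- r | P i) f i).
Proof.
move=> sU I r P f Uf; apply: big_ind => //; first exact: subspace0 sU.
exact: subspaceD sU.
Qed.

Lemma subspaceZ_inv U (c : F) x : subspace U -> c != 0 -> U (c *: x) -> U x.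
Proof.
move=> sU c0 Ucx; rewrite -[x](scalerK c0); exact: subspaceZ.
Qed.

Lemma linear_span_subspace (S : set A) : subspace (linear_span S).
Proof.
split=> [|x y Sx Sy|c x Sx] U [sU SU]; first exact: subspace0 sU.
  by apply: (subspaceD sU); [apply: Sx | apply: Sy].
by apply: (subspaceZ sU); apply: Sx.
Qed.

Lemma lie_generated_subsuperalgebra (S : set A) :
  lie_subsuperalgebra (lie_generated S).
Proof.
split=> [|b x Sx|x y Sx Sy]; first split=> [|x y Sx Sy|c x Sx].
- by move=> U [[sU _ _] _]; exact: subspace0 sU.
- move=> U [lU SU]; have [sU _ _] := lU.
  by apply: (subspaceD sU); [apply: Sx | apply: Sy].
- by move=> U [lU SU]; have [sU _ _] := lU; apply: (subspaceZ sU); apply: Sx.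
- by move=> U [lU SU]; apply: lie_graded => //; apply: Sx.
by move=> U [lU SU]; apply: lie_bracket => //; [apply: Sx | apply: Sy].
Qed.

Lemma super_partD b : {morph @super_part F n b : x y / x + y}.
Proof.
by move=> x y; apply/ffunP => s; rewrite !ffunE; case: ifP; rewrite ?addr0.
Qed.

Lemma super_partZ b (c : F) x : super_part b (c *: x) = c *: super_part b x.
Proof.
by apply/ffunP => s; rewrite !ffunE; case: ifP; rewrite ?scaler0.
Qed.

Lemma super_part0 b : super_part b (0 : A) = 0.
Proof. by apply/ffunP => s; rewrite !ffunE if_same. Qed.

Lemma super_part_delta b s :
  super_part b (delta s) = if odd_perm s == b then delta s else 0.
Proof.
apply/ffunP => t; rewrite !ffunE; case: (t =P s) => [->|/eqP/negbTE ts].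
  by case: ifP => _; rewrite ffunE ?eqxx.
by case: ifP; case: ifP; rewrite !ffunE ?ts.
Qed.

Lemma super_bracketDl x y z :
  super_bracket (x + y) z = super_bracket x z + super_bracket y z.
Proof.
rewrite /super_bracket -big_split; apply: eq_bigr => a _.
rewrite -big_split; apply: eq_bigr => b _ /=.
by rewrite super_partD mulrDl mulrDr scalerDr opprD addrACA.
Qed.

Lemma super_bracketDr x y z :
  super_bracket x (y + z) = super_bracket x y + super_bracket x z.
Proof.
rewrite /super_bracket -big_split; apply: eq_bigr => a _.
rewrite -big_split; apply: eq_bigr => b _ /=.
by rewrite super_partD mulrDl mulrDr scalerDr opprD addrACA.
Qed.

Lemma super_bracketZl c x y :
  super_bracket (c *: x) y = c *: super_bracket x y.
Proof.
rewrite /super_bracket scaler_sumr; apply: eq_bigr => a _.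
rewrite scaler_sumr; apply: eq_bigr => b _ /=.
rewrite super_partZ -scalerAl -scalerAr scalerBr; congr (_ - _).
by rewrite !scalerA mulrC.
Qed.

Lemma super_bracketZr c x y :
  super_bracket x (c *: y) = c *: super_bracket x y.
Proof.
rewrite /super_bracket scaler_sumr; apply: eq_bigr => a _.
rewrite scaler_sumr; apply: eq_bigr => b _ /=.
rewrite super_partZ -scalerAl -scalerAr scalerBr; congr (_ - _).
by rewrite !scalerA mulrC.
Qed.

Lemma super_bracketBr x y z :
  super_bracket x (y - z) = super_bracket x y - super_bracket x z.
Proof. by rewrite -scaleN1r super_bracketDr super_bracketZr scaleN1r. Qed.

Lemma ga_expand x : x = \sum_s x s *: delta s.
Proof.
apply/ffunP => t; rewrite sum_ffunE (bigD1 t) //= big1 => [|s st].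
  by rewrite !ffunE eqxx addr0 /GRing.scale /= mulr1.
by rewrite !ffunE eq_sym (negbTE st) scaler0.
Qed.

Lemma super_bracket_delta s t :
  super_bracket (delta s) (delta t)
  = delta (s * t)%g - (-1) ^+ (odd_perm s && odd_perm t) *: delta (t * s)%g.
Proof.
have hom u : super_part (odd_perm u) (delta u) = delta u.
  by rewrite super_part_delta eqxx.
by rewrite (super_bracket_homogeneous (hom s) (hom t)) !ga_deltaM.
Qed.

Lemma super_bracket_span U : subspace U ->
  (forall s t, U (super_bracket (delta s) (delta t))) ->
  forall x y, U (super_bracket x y).
Proof.
move=> sU Ust x y; rewrite (ga_expand x).
apply: (big_ind (fun z => U (super_bracket z y))) => [|x1 x2|s _].
- by rewrite -(scale0r 0) super_bracketZl scale0r; exact: subspace0 sU.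
- by rewrite super_bracketDl; exact: subspaceD.
rewrite super_bracketZl; apply: subspaceZ => //; rewrite (ga_expand y).
apply: (big_ind (fun z => U (super_bracket (delta s) z))) => [|y1 y2|t _].
- by rewrite -(scale0r 0) super_bracketZr scale0r; exact: subspace0 sU.
- by rewrite super_bracketDr; exact: subspaceD.
by rewrite super_bracketZr; apply: subspaceZ.
Qed.

Definition ga_conj s x : A := delta s^-1%g * x * delta s.

Lemma ga_conj_delta s t : ga_conj s (delta t) = delta (t ^ s)%g.
Proof. by rewrite /ga_conj !ga_deltaM conjgE mulgA. Qed.

Lemma ga_conjD s : {morph ga_conj s : x y / x + y}.
Proof. by move=> x y; rewrite /ga_conj mulrDr mulrDl. Qed.

Lemma ga_conjZ s c x : ga_conj s (c *: x) = c *: ga_conj s x.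
Proof. by rewrite /ga_conj -scalerAr -scalerAl. Qed.

Lemma ga_conj_sum s (I : Type) (r : seq I) (P : pred I) (f : I -> A) :
  ga_conj s (\sum_(i <- r | P i) f i) = \sum_(i <- r | P i) ga_conj s (f i).
Proof. by rewrite /ga_conj mulr_sumr mulr_suml. Qed.

Lemma ga_conjM s : {morph ga_conj s : x y / x * y}.
Proof.
move=> x y; have sV : delta s * delta s^-1%g = 1 by rewrite ga_deltaM mulgV.
by rewrite /ga_conj !mulrA -[_ * _ * delta s * _]mulrA sV mulr1.
Qed.

Lemma ga_conjB s : {morph ga_conj s : x y / x - y}.
Proof. by move=> x y; rewrite -!scaleN1r ga_conjD ga_conjZ. Qed.

Lemma super_part_conj s b x :
  super_part b (ga_conj s x) = ga_conj s (super_part b x).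
Proof.
rewrite (ga_expand x) ga_conj_sum.
rewrite !(big_morph _ (super_partD b) (super_part0 b)).
rewrite ga_conj_sum; apply: eq_bigr => t _.
rewrite ga_conjZ !super_partZ ga_conjZ ga_conj_delta.
rewrite !super_part_delta odd_permJ.
by case: ifP; rewrite ?ga_conj_delta // /ga_conj mulr0 mul0r.
Qed.

Lemma super_bracket_conj s x y :
  super_bracket (ga_conj s x) (ga_conj s y) = ga_conj s (super_bracket x y).
Proof.
rewrite /super_bracket ga_conj_sum; apply: eq_bigr => a _.
rewrite ga_conj_sum; apply: eq_bigr => b _.
by rewrite !super_part_conj -!ga_conjM -ga_conjZ ga_conjB.
Qed.

Lemma transposition_conj s t : is_transposition t -> is_transposition (t ^ s)%g.
Proof.
case/existsP=> i /existsP[j /andP[ij /eqP->]].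
apply/existsP; exists (s i); apply/existsP; exists (s j).
by rewrite (inj_eq perm_inj) ij tpermJ eqxx.
Qed.

(** Conjugation is an automorphism that preserves parity and permutes the transpositions, so the
    preimage of the generated superalgebra is a subsuperalgebra containing the generators. *)
Lemma lie_generated_conj s x :
  lie_generated (transpositions F n) x ->
  lie_generated (transpositions F n) (ga_conj s x).
Proof.
have lL := lie_generated_subsuperalgebra (transpositions F n).
have [sL _ _] := lL.
pose U := [set x | lie_generated (transpositions F n) (ga_conj s x)].
suff: lie_generated (transpositions F n) `<=` U by apply.
apply: smallest_sub; last first.
  move=> _ [t tt <-]; rewrite /U /= ga_conj_delta; apply: sub_gen_smallest.
  by exists (t ^ s)%g => //; apply: transposition_conj.
rewrite /U; split=> [|b y /= Uy|y z /= Uy Uz].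
  split=> [|y z /= Uy Uz|c y /= Uy].
  - by rewrite /= /ga_conj mulr0 mul0r; exact: subspace0 sL.
  - by rewrite ga_conjD; exact: (subspaceD sL).
  - by rewrite ga_conjZ; exact: (subspaceZ sL).
- by rewrite -super_part_conj; exact: (lie_graded lL).
by rewrite -super_bracket_conj; exact: (lie_bracket lL).
Qed.

End Subspaces.

(** * Congruence between a permutation and its conjugates modulo [L] *)

Section Congruence.
Variables (F : fieldType) (n : nat).
Local Notation A := (group_algebra F 'S_n).
Local Notation delta := (@ga_delta F 'S_n).
Local Notation L := (lie_generated (transpositions F n)).
Implicit Types (g h k s t u x y : 'S_n) (S : {set 'I_n}).

Hypothesis two_neq0 : 2%:R != 0 :> F.

Let lL : lie_subsuperalgebra L := lie_generated_subsuperalgebra _.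
Let sL : subspace L := lie_subspace lL.

(* [h] and its conjugate by [x] are congruent modulo [L], up to the sign which
   makes this equivalent to [x, x^-1 h] being in [L]. *)
Definition conj_congr h x : Prop :=
  L (delta h - (-1) ^+ (odd_perm x && ~~ odd_perm h) *: delta (h ^ x)%g).

(** The two elements coincide: $(xy)^x = yx$, and [x], [y] are both odd exactly when [x] is odd and
    [x * y] is even. *)
Lemma conj_congrE x y :
  conj_congr (x * y)%g x <-> L (super_bracket (delta x) (delta y)).
Proof.
rewrite /conj_congr super_bracket_delta odd_permM conjgE mulgA mulKg.
by case: (odd_perm x); case: (odd_perm y).
Qed.

(** Conjugating the congruence for [x] by [y] relates [h ^ y] to [h ^ (x * y)]; it is then chained
    with the congruence for [y], and the signs multiply. *)
Lemma conj_congrM h x y :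
  conj_congr h x -> conj_congr h y -> conj_congr h (x * y)%g.
Proof.
move=> hx hy; have /(lie_generated_conj y) := hx.
rewrite ga_conjB ga_conjZ !ga_conj_delta -conjgM.
move=> /(subspaceZ sL ((-1) ^+ (odd_perm y && ~~ odd_perm h))).
move=> /(subspaceD sL hy); rewrite scalerBr addrA subrK scalerA -signr_addb.
rewrite /conj_congr odd_permM; congr (L (_ - (-1) ^+ nat_of_bool _ *: _)).
by case: (odd_perm h); case: (odd_perm x); case: (odd_perm y).
Qed.

Lemma conj_congr1 h : conj_congr h 1%g.
Proof.
by rewrite /conj_congr odd_perm1 conjg1 scale1r subrr; exact: subspace0 sL.
Qed.

Lemma conj_congr_mem h x : L (delta h) -> conj_congr h x.
Proof.
move=> Lh; apply: (subspaceB sL) => //; apply: (subspaceZ sL).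
by rewrite -ga_conj_delta; apply: lie_generated_conj.
Qed.

Lemma mem_tperm i j : i != j -> L (delta (tperm i j)).
Proof.
move=> ij; apply: sub_gen_smallest; exists (tperm i j) => //.
by apply/existsP; exists i; apply/existsP; exists j; rewrite ij eqxx.
Qed.

(** Disjoint transpositions are odd and commute, so their super bracket is twice their product, and
    2 is invertible. *)
Lemma mem_tperm_tperm (i j k l : 'I_n) : uniq [:: i; j; k; l] ->
  L (delta (tperm i j * tperm k l)%g).
Proof.
move=> /= /and4P[]; rewrite !inE !negb_or => /and3P[ij ik il] /andP[jk jl] kl _.
have comm : (tperm k l * tperm i j)%g = (tperm i j * tperm k l)%g.
  by apply/commgP/conjg_fixP; rewrite tpermJ !tpermD // eq_sym.
apply: (subspaceZ_inv sL two_neq0); rewrite scaler_nat mulr2n.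
have := lie_bracket lL (mem_tperm ij) (mem_tperm kl).
by rewrite super_bracket_delta !odd_tperm ij kl comm scaleN1r opprK.
Qed.

(* For z = [x, y] and a sign e, the congruence for y gives z = e z^g modulo [L],
   while the one for x y gives z = - e z^g. *)
Lemma conj_congr_involution x y g :
    L (delta x) -> (x * x)%g = 1%g -> odd_perm x = false ->
    commute x g -> conj_congr y g -> conj_congr (x * y)%g (x * g)%g ->
  conj_congr (x * y)%g x.
Proof.
move=> Lx xx ox xg yg kxg; pose k := (x * y)%g.
have kx : (k ^ x)%g = (y * x)%g by rewrite conjgE mulgA mulKg.
set e : F := (-1) ^+ (odd_perm g && ~~ odd_perm y).
have ke : (-1) ^+ (odd_perm (x * g)%g && ~~ odd_perm k) = e :> F.
  by rewrite !odd_permM ox.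
have := lie_bracket lL Lx yg; rewrite super_bracketBr super_bracketZr.
rewrite !super_bracket_delta ox !scale1r -/e -/k -kx.
have -> : (x * y ^ g)%g = (k ^ g)%g.
  by rewrite conjMg; congr (_ * _)%g; apply/esym/conjg_fixP/commgP.
have -> : (y ^ g * x)%g = (k ^ (x * g))%g.
  by rewrite conjgM kx conjMg; congr (_ * _)%g; apply/esym/conjg_fixP/commgP.
move=> L1; have := kxg; rewrite /conj_congr -/k ke => L2.
have := lie_generated_conj x L2; rewrite ga_conjB ga_conjZ !ga_conj_delta.
have -> : ((k ^ (x * g)) ^ x)%g = (k ^ g)%g.
  by rewrite -conjgM xg -mulgA xx mulg1.
move=> L3; rewrite ox /= scale1r; apply: (subspaceZ_inv sL two_neq0).
have := subspaceD sL L1 (subspaceB sL L2 L3).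
congr (L _); rewrite scaler_nat mulr2n scalerBr.
move: (delta k) (delta (k ^ x)%g) => a b.
move: (e *: delta (k ^ g)%g) (e *: delta (k ^ (x * g))%g) => c d.
have -> : a - d - (b - c) = a - b + (c - d).
  by rewrite opprB [c - b]addrC addrACA [- d + c]addrC.
by rewrite addrACA addNr addr0.
Qed.

Definition conj_congr_all S h : Prop :=
  forall x, perm_on S x -> conj_congr h x.

(** The induction hypothesis in the form used below: [h] and [x] both act on [S] with [p]
    removed. *)
Definition conj_congr_common_fix S : Prop :=
  forall p h x, p \in S -> perm_on S h -> perm_on S x ->
    h p = p -> x p = p -> conj_congr h x.

Lemma conj_congr_all_tperm S h :
    (forall i j, i \in S -> j \in S -> i != j -> conj_congr h (tperm i j)) ->
  conj_congr_all S h.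
Proof.
move=> ht x; apply: (@perm_on_tperm_ind _ S (conj_congr h)); first last.
- exact: conj_congrM.
- exact: ht.
exact: conj_congr1.
Qed.

(** The transpositions of [S] that avoid [p] are covered by [IH], so a single one moving [p]
    suffices. It is split off from a product of two disjoint transpositions, treated by
    [conj_congr_involution]. *)
Lemma conj_congr_all_fix S p k :
    conj_congr_common_fix S -> (3 < #|S|)%N ->
    perm_on S k -> p \in S -> k p = p ->
  conj_congr_all S k.
Proof.
move=> IH ltS kS pS kp.
have kfix c d : c \in S -> d \in S -> c != p -> d != p ->
  conj_congr k (tperm c d).
  by move=> cS dS cp dp; apply: (IH p _ _ pS); rewrite ?tpermD ?perm_on_tperm.
have [k1|/perm_neq1[q kq]] := eqVneq k 1%g.
  (* The identity fixes everything, so any [z] outside [c], [d] is a common fixed point. *)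
  apply: conj_congr_all_tperm => c d cS dS _.
  have [|z zS] := @ex_notin_seq _ S [:: c; d]; first exact: leq_trans ltS.
  rewrite !inE negb_or => /andP[zc zd].
  apply: (IH z _ _ zS); rewrite ?perm_on_tperm ?k1 ?perm1 ?perm_on1 //.
  by rewrite tpermD // eq_sym.
set r := k q in kq.
have qS : q \in S by apply: perm_on_moved kS kq.
have rS : r \in S by rewrite perm_closed.
have qp : q != p by apply: contra_neq kq => qp; rewrite /r qp kp.
have rp : r != p by rewrite -kp /r (inj_eq perm_inj).
have [//|b bS] := @ex_notin_seq _ S [:: p; q; r].
rewrite !inE !negb_or => /and3P[bp bq br].
pose g := tperm p b; pose t := tperm q r; pose x := (g * t)%g.
have gS : perm_on S g by apply: perm_on_tperm.
have tS : perm_on S t by apply: perm_on_tperm.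
have gt : commute g t.
  by apply/commgP/conjg_fixP; rewrite /g tpermJ !tpermD // eq_sym.
have xx : (x * x)%g = 1%g.
  by rewrite /x {2}gt mulgA -[(g * t * t)%g]mulgA tperm2 mulg1 tperm2.
have xg : (x * g)%g = t by rewrite /x gt -mulgA tperm2 mulg1.
pose y := (x * k)%g.
(* [x] maps [k q] back to [q], so [y] shares the fixed point [r] with [g], while
   [x g = t] shares the fixed point [p] with [k]. *)
have gr : g r = r by rewrite tpermD // eq_sym.
have yr : y r = r.
  by rewrite /y /x !permM gr tpermR.
have kE : k = (x * y)%g by rewrite /y mulgA xx mul1g.
have kt : conj_congr k t by apply: kfix.
have kx : conj_congr k x.
  suff: conj_congr (x * y)%g x by rewrite -kE.
  apply: (@conj_congr_involution x y g); first last.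
  - by rewrite xg -kE.
  - apply: (IH r _ _ rS _ gS yr gr).
    by do 2?[apply: perm_onM => //].
  - by rewrite /commute xg /x mulgA tperm2 mul1g.
  - by rewrite odd_permM !odd_tperm eq_sym bp eq_sym kq.
  - exact: xx.
  apply: mem_tperm_tperm; rewrite /= !inE !negb_or.
  by do ?[apply/andP; split]; rewrite // eq_sym.
have kg : conj_congr k g.
  have -> : g = (x * t)%g by rewrite /x -mulgA tperm2 mulg1.
  exact: conj_congrM.
have kp_ d : d \in S -> d != p -> conj_congr k (tperm p d).
  move=> dS dp; have [->//|db] := eqVneq d b.
  (* Conjugation by [g] carries [(b d)], which avoids [p], to [(p d)]. *)
  have -> : tperm p d = (g * tperm b d * g)%g.
    have -> : tperm p d = (tperm b d ^ g)%g.
      by rewrite tpermJ tpermR tpermD // eq_sym.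
    by rewrite conjgE tpermV mulgA.
  by apply: (conj_congrM (conj_congrM kg (kfix _ _ bS dS bp dp)) kg).
apply: conj_congr_all_tperm => c d cS dS cd.
have [cp|cp] := eqVneq c p.
  by rewrite cp; apply: kp_; rewrite // -cp eq_sym.
have [dp|dp] := eqVneq d p; first by rewrite dp tpermC; apply: kp_.
exact: kfix.
Qed.

(* [y] can be replaced by a conjugate sharing the fixed point [p] with [x]. *)
Lemma conj_congr_of_fix S p q x y :
    conj_congr_common_fix S -> perm_on S x -> perm_on S y -> L (delta x) ->
    p \in S -> x p = p -> q \in S -> y q = q -> conj_congr_all S y ->
  conj_congr (x * y)%g x.
Proof.
move=> IH xS yS Lx pS xp qS yq yall; pose g := tperm q p.
have gS : perm_on S g by apply: perm_on_tperm.
have ygp : (y ^ g)%g p = p by rewrite -{1}(tpermL q p) permJ yq tpermL.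
have ygS : perm_on S (y ^ g)%g.
  by rewrite conjgE; do 2?[apply: perm_onM => //]; apply: perm_onV.
have xyg : conj_congr (x * y ^ g)%g x.
  by apply: (IH p _ _ pS) => //; [apply: perm_onM | rewrite permM xp].
(* The bracket $[x, y]$ is the sum of $[x, y - e y^g]$ and $e [x, y^g]$, both in [L]. *)
have := lie_bracket lL Lx (yall g gS).
rewrite super_bracketBr super_bracketZr; set e := (-1) ^+ _ => Lxy.
apply/conj_congrE; move/conj_congrE/(subspaceZ sL e) in xyg.
by have := subspaceD sL Lxy xyg; rewrite subrK.
Qed.

(** Once [(i j)] with [j = u i] is split off, the remaining even factor [w] fixes [j] and acts on at
    most two points, hence is trivial. *)
Lemma odd_perm_on_le3 S u : (#|S| <= 3)%N -> perm_on S u -> odd_perm u ->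
  L (delta u).
Proof.
move=> leS uS ou; have [|i ui] := @perm_neq1 _ u.
  by apply: contraTneq ou => ->; rewrite odd_perm1.
have iS : i \in S by apply: perm_on_moved ui.
set j := u i in ui; pose w := (tperm i j * u)%g.
have jS : j \in S by rewrite perm_closed.
have wj : w j = j by rewrite permM tpermR.
have uE : u = (tperm i j * w)%g by rewrite mulgA tperm2 mul1g.
have wS : perm_on (S :\ j)%SET w.
  by apply: perm_on_setD1 => //; apply: perm_onM => //; apply: perm_on_tperm.
have ow : odd_perm w = false by rewrite odd_mul_tperm eq_sym ui ou.
have [w1|/perm_neq1[k wk]] := eqVneq w 1%g.
  by rewrite uE w1 mulg1; apply: mem_tperm; rewrite eq_sym.
have kS : k \in (S :\ j)%SET by apply: perm_on_moved wk.
have wkS : w k \in (S :\ j)%SET by rewrite perm_closed.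
have w2S : w (w k) \in (S :\ j)%SET by rewrite perm_closed.
suff wE : w = tperm k (w k) by rewrite wE odd_tperm eq_sym wk in ow.
have [[kj kS'] [wkj wkS'] [w2j w2S']] : [/\ k != j /\ k \in S,
    w k != j /\ w k \in S & w (w k) != j /\ w (w k) \in S].
  by move: kS wkS w2S; rewrite !inE; do 3!move=> /andP[? ?].
(* Otherwise [j], [k], [w k], [w (w k)] would be four distinct points of [S]; likewise below for a
   moved point [a] other than [k] and [w k]. *)
have wkk : w (w k) = k.
  apply/eqP; apply: contraTT leS => wwk; rewrite -ltnNge.
  apply: (@leq_size_card _ _ [:: w (w k); w k; k; j]); rewrite /= ?inE.
    by rewrite !negb_or (inj_eq perm_inj) kj wkj w2j wk wwk.
  by rewrite jS kS' wkS' w2S'.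
apply/permP => a; case: tpermP => [->|->|/eqP ak /eqP awk] //.
apply: contraTeq leS => wa; rewrite -ltnNge.
have aS : a \in (S :\ j)%SET by apply: perm_on_moved wa.
have [aj aS'] : a != j /\ a \in S by move: aS; rewrite !inE => /andP.
apply: (@leq_size_card _ _ [:: a; w k; k; j]); rewrite /= ?inE.
  by rewrite !negb_or kj wkj aj wk ak awk.
by rewrite jS kS' wkS' aS'.
Qed.

(** An odd [h] lies in [L]. An even [h] is [(c d)] times an odd permutation, so the bracket to be
    tested has both entries in [L]. *)
Lemma conj_congr_all_le3 S h : (#|S| <= 3)%N -> perm_on S h ->
  conj_congr_all S h.
Proof.
move=> leS hS; apply: conj_congr_all_tperm => c d cS dS cd.
have [oh|oh] := boolP (odd_perm h).
  by apply: conj_congr_mem; apply: (odd_perm_on_le3 leS hS oh).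
have -> : h = (tperm c d * (tperm c d * h))%g by rewrite mulgA tperm2 mul1g.
have tS : perm_on S (tperm c d * h)%g.
  by apply: perm_onM => //; apply: perm_on_tperm.
have ot : odd_perm (tperm c d * h)%g by rewrite odd_mul_tperm cd (negbTE oh).
apply/conj_congrE.
exact: (lie_bracket lL (mem_tperm cd) (odd_perm_on_le3 leS tS ot)).
Qed.

(** * Permutations without fixed points in [S] *)

Section FixedPointFree.
Variables (S : {set 'I_n}) (h : 'S_n).
Hypotheses (IH : conj_congr_common_fix S) (ltS : (3 < #|S|)%N).
Hypotheses (hS : perm_on S h) (h_neq : forall i, i \in S -> h i != i).

Let hSE i : (h i \in S) = (i \in S). Proof. exact: perm_closed. Qed.

(** The cofactor [y = x * h] fixes [h i], so the case with a fixed point applies to [y], and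
    [conj_congr_of_fix] to [h = x * y]. *)
Lemma conj_congr_fpf_mem x i p :
    i \in S -> p \in S -> perm_on S x -> L (delta x) ->
    (x * x)%g = 1%g -> x (h i) = i -> x p = p ->
  conj_congr h x.
Proof.
move=> iS pS xS Lx xx xhi xp; pose y := (x * h)%g.
have yi : y (h i) = h i by rewrite permM xhi.
have hiS : h i \in S by rewrite hSE.
have yS : perm_on S y by apply: perm_onM.
suff: conj_congr (x * y)%g x by rewrite /y mulgA xx mul1g.
apply: (conj_congr_of_fix IH xS yS Lx pS xp hiS yi).
exact: (conj_congr_all_fix IH ltS yS hiS yi).
Qed.

Lemma conj_congr_fpf_step i : i \in S -> conj_congr h (tperm i (h i)).
Proof.
move=> iS; have ni := h_neq iS; have hiS : h i \in S by rewrite hSE.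
have [|p pS] := @ex_notin_seq _ S [:: i; h i]; first exact: leq_trans ltS.
rewrite !inE negb_or => /andP[pi phi].
apply: (@conj_congr_fpf_mem _ i p) => //.
- exact: perm_on_tperm.
- by apply: mem_tperm; rewrite eq_sym.
- exact: tperm2.
- exact: tpermR.
by rewrite tpermD // eq_sym.
Qed.

(** Both [t = (i h(i))] and [x = t (c d)] satisfy the congruence, and [(c d) = t x]. *)
Lemma conj_congr_fpf_gt4 c d : (4 < #|S|)%N ->
  c \in S -> d \in S -> c != d -> conj_congr h (tperm c d).
Proof.
move=> ltS5 cS dS cd.
(* Excluding the preimages of [c] and [d] as well keeps [h i] away from both. *)
have [//|i iS] := @ex_notin_seq _ S [:: c; d; h^-1%g c; h^-1%g d].
have hVE a : (i == h^-1%g a) = (h i == a).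
  by rewrite -(inj_eq (@perm_inj _ h)) permKV.
rewrite !inE !hVE !negb_or => /and4P[ic id hic hid].
have ni := h_neq iS; have hiS : h i \in S by rewrite hSE.
(* The fixed point of [x] has to be a fifth point of [S]. *)
have [//|p pS] := @ex_notin_seq _ S [:: i; h i; c; d].
rewrite !inE !negb_or => /and4P[pi phi pc pd].
pose t := tperm i (h i); pose s := tperm c d; pose x := (t * s)%g.
have ts : commute t s.
  by apply/commgP/conjg_fixP; rewrite /t tpermJ !tpermD // eq_sym.
have -> : tperm c d = (t * x)%g by rewrite mulgA tperm2 mul1g.
apply: conj_congrM; first exact: conj_congr_fpf_step.
apply: (@conj_congr_fpf_mem _ i p) => //.
- by apply: perm_onM; apply: perm_on_tperm.
- apply: mem_tperm_tperm; rewrite /= !inE !negb_or.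
  by rewrite ic id hic hid cd eq_sym ni.
- by rewrite /x {2}ts mulgA -[(t * s * s)%g]mulgA tperm2 mulg1 tperm2.
- by rewrite permM tpermR tpermD // eq_sym.
by rewrite permM !tpermD // eq_sym.
Qed.

(** If [d] lies in the orbit of [c], the transpositions [(i h(i))] along the orbit are chained from
    [c] to [d]. Otherwise [h] is a product of two disjoint transpositions, hence in [L]. *)
Lemma conj_congr_fpf_eq4 c d : #|S| = 4 ->
  c \in S -> d \in S -> c != d -> conj_congr h (tperm c d).
Proof.
move=> S4 cS dS cd; pose a := h c.
have aS : a \in S by rewrite hSE.
have ac : a != c := h_neq cS.
have Gc : conj_congr h (tperm c a) := conj_congr_fpf_step cS.
have [<-//|ad] := eqVneq a d.
pose b := h a; have bS : b \in S by rewrite hSE.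
have ba : b != a := h_neq aS.
(* [(i k)] is the conjugate of [(j k)] by [(i j)]. *)
have trans (i j k : 'I_n) : i != k -> j != k ->
    conj_congr h (tperm i j) -> conj_congr h (tperm j k) ->
  conj_congr h (tperm i k).
  move=> ik jk Gij Gjk.
  have -> : tperm i k = (tperm i j * tperm j k * tperm i j)%g.
    by rewrite -{1}[tperm i j]tpermV -mulgA -conjgE tpermJ tpermR tpermD.
  exact: (conj_congrM (conj_congrM Gij Gjk) Gij).
have Ga : conj_congr h (tperm a b) := conj_congr_fpf_step aS.
have [bd|bd] := eqVneq b d.
  by move: Ga; rewrite bd; apply: (trans _ _ _ cd ad Gc).
have [bc|bc] := eqVneq b c.
  (* Here [h] swaps [c] and [a]; the other two points [d] and [e] must then be swapped too. *)
  pose e := h d; have eS : e \in S by rewrite hSE.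
  have ed : e != d := h_neq dS.
  have ea : e != a by rewrite (inj_eq perm_inj) eq_sym.
  have ec : e != c by rewrite -bc (inj_eq perm_inj) eq_sym.
  have S_eq i : i \in S -> i \in [:: e; d; a; c].
    apply: mem_seq_of_card; rewrite ?S4 //= ?inE ?eS ?dS ?aS ?cS //.
    by rewrite !negb_or ed ea ec ac ![d == _]eq_sym ad cd.
  have he : h e = d.
    have : h e \in [:: e; d; a; c] by rewrite S_eq ?hSE.
    have hea : h e != a by rewrite (inj_eq perm_inj).
    have hec : h e != c by rewrite -bc (inj_eq perm_inj).
    rewrite !inE (negbTE hea) (negbTE hec) (negbTE (h_neq eS)) !orbF.
    by move/eqP.
  suff hE : h = (tperm c a * tperm d e)%g.
    apply: conj_congr_mem; rewrite hE; apply: mem_tperm_tperm.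
    rewrite /= !inE !negb_or ad cd ![_ == e]eq_sym ec ea ed.
    by rewrite eq_sym ac.
  apply/permP => i; rewrite permM; have [iS|iS] := boolP (i \in S); last first.
    have Si j : j \in S -> j != i by apply: contraTneq => ->.
    by rewrite !tpermD ?Si // (out_perm hS).
  have := S_eq i iS; rewrite !inE => /or4P[] /eqP->.
  - by rewrite he [tperm c a e]tpermD 1?eq_sym // tpermR.
  - by rewrite [tperm c a d]tpermD // tpermL.
  - by rewrite -/b bc tpermR tpermD // eq_sym.
  by rewrite -/a tpermL tpermD // eq_sym.
(* The only alternative is [h b = c]: a 3-cycle on [c], [a], [b], which would force [h] to fix
   [d]. *)
have hb : h b = d.
  have S_eq i : i \in S -> i \in [:: b; a; c; d].
    apply: mem_seq_of_card; rewrite ?S4 //= ?inE ?bS ?dS ?aS ?cS //.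
    by rewrite !negb_or ba bc bd ac ad cd.
  have : h b \in [:: b; a; c; d] by rewrite S_eq ?hSE.
  have hba : h b != a by rewrite (inj_eq perm_inj).
  rewrite !inE (negbTE (h_neq bS)) (negbTE hba) /=.
  case/orP=> /eqP // hb.
  have : h d \in [:: b; a; c; d] by rewrite S_eq ?hSE.
  have hdb : h d != b by rewrite (inj_eq perm_inj) eq_sym.
  have hda : h d != a by rewrite (inj_eq perm_inj) eq_sym.
  have hdc : h d != c by rewrite -hb (inj_eq perm_inj) eq_sym.
  by rewrite !inE (negbTE hdb) (negbTE hda) (negbTE hdc) (negbTE (h_neq dS)).
have Gb : conj_congr h (tperm b d) by rewrite -hb; apply: conj_congr_fpf_step.
have cb : c != b by rewrite eq_sym.
have ab : a != b by rewrite eq_sym.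
exact: (trans _ _ _ cd bd (trans _ _ _ cb ab Gc Ga) Gb).
Qed.

End FixedPointFree.

Lemma conj_congr_all_perm_on S h : perm_on S h -> conj_congr_all S h.
Proof.
have [m] := ubnP #|S|; elim: m S h => // m IHm S h; rewrite ltnS => leSm hS.
have IH : conj_congr_common_fix S.
  move=> p k x pS kS xS kp xp; apply: (IHm (S :\ p)%SET).
  - by move: leSm; rewrite (cardsD1 p) pS.
  - exact: perm_on_setD1.
  - exact: perm_on_setD1.
have [/conj_congr_all_le3|ltS] := leqP #|S| 3; first exact.
have [/existsP[p /andP[pS /eqP hp]]|] := boolP [exists p in S, h p == p].
  exact: (conj_congr_all_fix IH ltS hS pS hp).
rewrite negb_exists_in => /forall_inP h_neq.
apply: conj_congr_all_tperm => c d cS dS cd.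
have [S5|leS] := ltnP 4 #|S|.
  exact: (conj_congr_fpf_gt4 IH ltS hS h_neq).
have S4 : #|S| = 4 by apply/eqP; rewrite eqn_leq leS.
exact: (conj_congr_fpf_eq4 IH ltS hS h_neq).
Qed.

End Congruence.

(** * The derived subalgebra and the two inclusions *)

Section DerivedSubalgebra.
Variables (F : fieldType) (n : nat).
Local Notation A := (group_algebra F 'S_n).
Local Notation delta := (@ga_delta F 'S_n).
Local Notation D := (derived_subalgebra [set: A]).
Local Notation T := (transposition_sum F n).
Implicit Types (x y : A) (s t : 'S_n).

Let sD : subspace D := linear_span_subspace _.

Lemma derived_subalgebra_bracket x y : D (super_bracket x y).
Proof. by apply: sub_gen_smallest; exists x => //; exists y. Qed.

(** A bracket of two basis vectors is homogeneous, since [s * t] and [t * s] have the same parity;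
    its components are itself and 0. *)
Lemma derived_subalgebra_graded b x : D x -> D (super_part b x).
Proof.
have sU : subspace [set y | D (super_part b y)].
  split=> [|y z /= Dy Dz|c y /= Dy].
  - by rewrite /= super_part0; exact: subspace0 sD.
  - by rewrite super_partD; apply: (subspaceD sD).
  by rewrite super_partZ; apply: (subspaceZ sD).
suff: D `<=` [set y | D (super_part b y)] by apply.
apply: smallest_sub => // _ [y _ [z _ <-]].
apply: (super_bracket_span sU) => s t /=.
have := derived_subalgebra_bracket (delta s) (delta t).
rewrite super_bracket_delta -scaleNr super_partD super_partZ !super_part_delta.
rewrite !odd_permM [odd_perm t (+) _]addbC; case: ifP => // _ _.
by rewrite scaler0 addr0; exact: subspace0 sD.
Qed.

(** By bilinearity only brackets of basis vectors matter, and these are congruences for permutations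
    of the full set of points. *)
Lemma derived_subalgebra_sub_lie_generated : 2%:R != 0 :> F ->
  D `<=` lie_generated (transpositions F n).
Proof.
move=> two_neq0; have lL := lie_generated_subsuperalgebra (transpositions F n).
apply: smallest_sub; first exact: lie_subspace lL.
move=> _ [x _ [y _ <-]]; apply: (super_bracket_span (lie_subspace lL)) => s t.
apply/conj_congrE.
apply: (conj_congr_all_perm_on two_neq0 (S := [set: 'I_n]%SET)).
  by apply/fintype.subsetP => i; rewrite inE.
by apply/fintype.subsetP => i; rewrite inE.
Qed.

Lemma odd_transposition s : is_transposition s -> odd_perm s.
Proof. by case/existsP=> i /existsP[j /andP[ij /eqP->]]; rewrite odd_tperm. Qed.

(** Conjugation by [(i k)] turns [(i j)] into [(k m)]; then [(m l)] fixes [k] and sends [m] to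
    [l]. *)
Lemma transposition_conjugate s t :
  is_transposition s -> is_transposition t -> exists g, t = (s ^ g)%g.
Proof.
case/existsP=> i /existsP[j /andP[ij /eqP->]].
case/existsP=> k /existsP[l /andP[kl /eqP->]].
pose m := tperm i k j.
have mk : m != k by rewrite -(tpermL i k) (inj_eq perm_inj) eq_sym.
exists (tperm i k * tperm m l)%g.
by rewrite tpermJ !permM tpermL -/m tpermL tpermD // eq_sym.
Qed.

(** With $t = s^g$, the difference is the bracket of $g$ and $g^{-1}s$: since $s$ is odd, these are
    not both odd, and the bracket is a commutator. *)
Lemma derived_subalgebra_transpositionB s t :
  is_transposition s -> is_transposition t -> D (delta s - delta t).
Proof.
move=> ts tt; have [g ->] := transposition_conjugate ts tt.
have := derived_subalgebra_bracket (delta g) (delta (g^-1 * s)%g).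
rewrite super_bracket_delta odd_permM odd_permV (odd_transposition ts).
by rewrite mulKVg -mulgA -conjgE addbT andbN scale1r.
Qed.

Lemma super_part_transposition_sum b : super_part b T = if b then T else 0.
Proof.
rewrite (big_morph _ (@super_partD F n b) (@super_part0 F n b)).
under eq_bigr => s ts do rewrite super_part_delta (odd_transposition ts).
by case: b => //=; rewrite big1.
Qed.

Lemma lie_generated_sub_derived_subalgebra : [pchar F] =i pred0 ->
  lie_generated (transpositions F n) `<=`
  [set x + c *: T | x in D & c in [set: F]].
Proof.
move=> /pcharf0P F0; have UP x : [set x + c *: T | x in D & c in [set: F]] x <->
    exists c, D (x - c *: T).
  split=> [[y Dy [c _ <-]]|[c Dx]]; first by exists c; rewrite addrK.
  by exists (x - c *: T) => //; exists c; rewrite ?subrK.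
apply: smallest_sub; last first.
  move=> _ [s ts <-]; apply/UP.
  (* Averaging $s - t$ over all [N] transpositions $t$ gives $s - N^{-1} T$, where [N] is invertible
     in characteristic zero. *)
  pose N := #|[pred t : 'S_n | is_transposition t]|.
  have N0 : N%:R != 0 :> F.
    by rewrite F0 -lt0n; apply/card_gt0P; exists s.
  exists N%:R^-1; apply: (subspaceZ_inv sD N0); rewrite scalerBr scalerKV //.
  have -> : N%:R *: delta s = \sum_(t : 'S_n | is_transposition t) delta s.
    by rewrite sumr_const scaler_nat.
  rewrite /transposition_sum -sumrB; apply: (subspace_sum sD) => t tt.
  exact: derived_subalgebra_transpositionB.
split=> [|b x /UP[c Dx]|x y _ _]; last 1 first.
(* All brackets already lie in [D], so closure needs no multiple of [T]. *)
- by apply/UP; exists 0; rewrite scale0r subr0; apply: derived_subalgebra_bracket.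
- split=> [|x y /UP[c Dx] /UP[d Dy]|c x /UP[d Dx]]; apply/UP.
  + by exists 0; rewrite scale0r subr0; exact: subspace0 sD.
  + exists (c + d); rewrite scalerDl opprD addrACA; exact: (subspaceD sD).
  + by exists (c * d); rewrite -scalerA -scalerBr; apply: (subspaceZ sD).
(* [T] is odd, so it contributes to the odd component only. *)
apply/UP; exists (if b then c else 0).
have := derived_subalgebra_graded b Dx.
rewrite -scaleN1r scalerA super_partD super_partZ super_part_transposition_sum.
by case: b; rewrite ?scaler0 ?scale0r ?subr0 ?addr0 // -scalerA scaleN1r.
Qed.

End DerivedSubalgebra.

Theorem theorem4p7p3 (R : realType) (n : nat) (hn : (2 <= n)%N) :
  lie_generated (transpositions R[i] n) =
  [set x + c *: transposition_sum R[i] n |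
     x in derived_subalgebra [set: group_algebra R[i] 'S_n] & c in [set: R[i]]].
Proof.
apply/seteqP; split.
  by apply: lie_generated_sub_derived_subalgebra; apply: Num.Theory.pchar_num.
have lL := lie_generated_subsuperalgebra (transpositions R[i] n).
have sL := lie_subspace lL.
move=> _ [x Dx [c _ <-]]; apply: (subspaceD sL).
  by apply: derived_subalgebra_sub_lie_generated Dx; rewrite Num.Theory.pnatr_eq0.
apply: (subspaceZ sL); apply: (subspace_sum sL) => s ts.
by apply: sub_gen_smallest; exists s.
Qed.
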